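(* Let $\mathcal H$ be a real Hilbert space and let $f:\mathcal H\to\mathbb R$ be convex and Fréchet differentiable, with $L$-Lipschitz continuous gradient for some $L>0$, and with $X^\star:=\arg\min_{\mathcal H} f\neq\varnothing$; put $f^\star:=\min_{\mathcal H}f$. Let $\alpha\ge 3$, $0<s\le 1/L$, $\beta>0$, and let $(x_k)_{k\ge 0}$, $(y_k)_{k\ge 1}$ be generated by IGAHD (see context) from arbitrary $x_0,x_1\in\mathcal H$. Suppose that $$0<\beta L\sqrt{s}<1+\sqrt{1+sL(1-sL)}.$$ Then, for a fixed $x^\star\in X^\star$, the energy sequence $(\mathcal E_k)$ (see context) is nonincreasing from some index onward, and $$f(x_k)-f^\star=O(k^{-2})\quad (k\to\infty).$$ Moreover, $$\sum_{k=1}^{+\infty}k^2\|\nabla f(x_k)\|^2<+\infty,\qquad \sum_{k=1}^{+\infty}k^2\|\nabla f(y_k)\|^2<+\infty.$$ Consequently, $$\|\nabla f(x_k)\|=o(k^{-1}),\qquad \|\nabla f(y_k)\|=o(k^{-1}),$$ and $$\min_{1\le i\le k}\|\nabla f(x_i)\|^2=O(k^{-3}),\qquad \min_{1\le i\le k}\|\nabla f(y_i)\|^2=O(k^{-3}).$$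
   Context: IGAHD: given $x_0,x_1\in\mathcal H$, for $k\ge1$, $$a_k=1-\frac{\alpha}{k},\qquad y_k=x_k+a_k(x_k-x_{k-1})-\beta\sqrt{s}\,\bigl(\nabla f(x_k)-\nabla f(x_{k-1})\bigr)-\frac{\beta\sqrt{s}}{k}\nabla f(x_{k-1}),\qquad x_{k+1}=y_k-s\nabla f(y_k).$$ Energy: for $k\ge 1$ let $\tau_k:=\frac{k-1}{\alpha-1}$ and, for a fixed $x^\star\in X^\star$, $$v_k:=x_{k-1}-x^\star+\tau_k\bigl(x_k-x_{k-1}+\beta\sqrt{s}\,\nabla f(x_{k-1})\bigr),\qquad \mathcal E_k:=\tau_k^2\bigl(f(x_k)-f^\star\bigr)+\frac{1}{2s}\|v_k\|^2.$$ *)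

(* Defs.v *)
From HB Require Import structures.
From mathcomp Require Import all_boot all_order all_algebra.
From mathcomp Require Import all_classical all_reals all_analysis.
From mathcomp Require Import ring lra.

Set Implicit Arguments.
Unset Strict Implicit.
Unset Printing Implicit Defensive.

Import Order.TTheory GRing.Theory Num.Theory.
Import numFieldNormedType.Exports.

Local Open Scope classical_set_scope.
Local Open Scope ring_scope.

(** A real Hilbert space is a complete normed module [H] together with an inner
    product [dot] (symmetric, bilinear, positive definite: [{dot H for idfun}])
    that induces the norm of [H]. *)
Definition induces_norm (R : realType) (H : completeNormedModType R)
    (dot : {dot H for idfun}) : Prop :=
  forall u : H, `|u| ^+ 2 = dot u u.

(** The gradient is the Riesz representative of the Fréchet differential
    (see [gradP]); where [f] is not differentiable its value is meaningless. *)
Definition grad (R : realType) (H : completeNormedModType R)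
    (dot : {dot H for idfun}) (f : H -> R^o) (x : H) : H :=
  get [set g : H | forall h : H, 'd f x h = dot g h].

Section riesz.
Context (R : realType) (H : completeNormedModType R) (dot : {dot H for idfun}).
Context (hdot : induces_norm dot).

Let dotC u v : dot u v = dot v u.
Proof. by have := @hermitian_subproof _ _ _ _ dot u v; rewrite /= expr0 mul1r. Qed.

Let normD2 (a b : R) (u v : H) : `|a *: u + b *: v| ^+ 2 =
  a ^+ 2 * `|u| ^+ 2 + 2 * a * b * dot u v + b ^+ 2 * `|v| ^+ 2.
Proof.
rewrite !hdot linearDr !linearDl !linearZr !linearZl_LR /= (dotC v u).
rewrite /GRing.scale/=; ring.
Qed.

Lemma riesz (phi : {linear H -> R^o}) : continuous phi ->
  exists g, forall h, phi h = dot g h.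
Proof.
move=> cphi.
have [M M0 phiM] : exists2 M, 0 < M & forall u, `|phi u| <= M * `|u|.
  have /linear_boundedP [r [rreal hr]] : bounded_near phi (nbhs 0).
    exact: continuous_linear_bounded (cphi 0).
  exists (`|r| + 1); first by rewrite ltr_wpDl.
  by apply: hr; rewrite (le_lt_trans (ler_norm r)) ?ltrDl.
pose F u : R := `|u| ^+ 2 - 2 * phi u.
have FD (a b : R) u v : F (a *: u + b *: v) =
    a ^+ 2 * `|u| ^+ 2 + 2 * a * b * dot u v + b ^+ 2 * `|v| ^+ 2
    - 2 * (a * phi u + b * phi v).
  by rewrite /F normD2 linearD !linearZ.
have Flb u : - M ^+ 2 <= F u.
  have := phiM u; rewrite ler_norml => /andP[_ h].
  have := sqr_ge0 (`|u| - M); rewrite /F; nra.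
have hF : has_inf (range F).
  split; first by exists (F 0), 0.
  by exists (- M ^+ 2) => _ [u _ <-].
pose m := inf (range F).
have mF u : m <= F u by apply: ge_inf; [case: hF|exists u].
have /choice [u Fu] : forall n : nat, exists u, F u < m + n.+1%:R^-1.
  move=> n; have [||_ [u _ <-] Hu] := @inf_adherent _ (range F) n.+1%:R^-1.
  - by rewrite invr_gt0.
  - by [].
  - by exists u.
have key v w : `|v - w| ^+ 2 <= 2 * (F v + F w - 2 * m).
  have := mF (2^-1 *: v + 2^-1 *: w); rewrite FD.
  have := normD2 1 (-1) v w; rewrite scale1r scaleN1r /F => -> .
  nra.
have ucvg : cvg (u @ \oo).
  apply/cauchy_cvgP/cauchyP => e e0.
  have e2 : 0 < e ^+ 2 / 8 by rewrite divr_gt0 ?exprn_gt0.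
  have [N _ hN] : \forall N \near \oo, N.+1%:R^-1 < e ^+ 2 / 8 :> R.
    exact: near_infty_natSinv_lt (PosNum e2).
  exists (u N); exists N => // k /= Nk.
  rewrite -ball_normE /ball_/= -(@ltr_pXn2r _ 2) ?nnegrE ?normr_ge0 ?(ltW e0)//.
  have h1 : k.+1%:R^-1 < e ^+ 2 / 8 :> R by exact: hN.
  have h2 : N.+1%:R^-1 < e ^+ 2 / 8 :> R by apply: hN => /=.
  have := key (u N) (u k); have := Fu N; have := Fu k.
  move: h1 h2; rewrite -/m.
  move: (F (u N)) (F (u k)) (N.+1%:R^-1) (k.+1%:R^-1) (`|u N - u k| ^+ 2).
  by move=> A B C D E h1 h2 h3 h4 h5; lra.
pose g : H := lim (u @ \oo).
have Fc : continuous F.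
  move=> z; apply: cvgB.
    under eq_fun do rewrite expr2.
    by rewrite expr2; apply: cvgM; exact: norm_continuous.
  by apply: cvgM; [exact: cvg_cst|exact: cphi].
have Fg : F g <= m.
  apply/ler_addgt0Pr => eps eps0.
  have FuF : F (u n) @[n --> \oo] --> F g.
    exact: (cvg_comp u F ucvg (Fc g)).
  rewrite -(cvg_lim _ FuF)//; apply: limr_le.
    by apply/cvg_ex; exists (F g).
  have [N _ hN] := near_infty_natSinv_lt (PosNum eps0).
  exists N => // k /= Nk; apply: ltW; apply: lt_trans (Fu k) _.
  by rewrite ltrD2l; exact: hN.
exists g => h.
pose c := phi h - dot g h.
have E t : 0 <= t ^+ 2 * `|h| ^+ 2 - 2 * t * c.
  have := le_trans Fg (mF (1 *: g + t *: h)); rewrite FD /F /c; nra.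
apply/eqP; rewrite -subr_eq0 -/c; apply/eqP.
have P : 0 < `|h| ^+ 2 + 1 by rewrite ltr_wpDl ?sqr_ge0.
have := E (c / (`|h| ^+ 2 + 1)).
set N := `|h| ^+ 2 in P *; set d := c / _ => Ed.
have cE : c = d * (N + 1) by rewrite /d divfK ?gt_eqF.
have d0 : d = 0.
  apply/eqP; rewrite -sqrf_eq0 eq_le sqr_ge0 andbT.
  have N0 : 0 <= N by exact: sqr_ge0.
  move: Ed; rewrite cE; have := sqr_ge0 d; nra.
by rewrite cE d0 mul0r.
Qed.

Lemma gradP (f : H -> R^o) (x : H) : differentiable f x ->
  forall h, 'd f x h = dot (grad dot f x) h.
Proof.
by move=> df; have := riesz (diff_continuous df); exact: getPex.
Qed.

End riesz.

Definition argmin (T : Type) (R : realType) (f : T -> R) : set T :=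
  [set z | forall w, f z <= f w].

Definition minval (T : Type) (R : realType) (f : T -> R) : R := inf (range f).

Section igahd.
Context (R : realType) (H : completeNormedModType R) (dot : {dot H for idfun}).
Context (f : H -> R^o) (alpha beta s : R).

Local Notation "'∇f'" := (grad dot f).

(** The sequence [y] is only constrained at indices [k >= 1]. *)
Definition igahd (x y : H^nat) : Prop :=
  forall k : nat, (1 <= k)%N ->
    y k = x k + (1 - alpha / k%:R) *: (x k - x k.-1)
          - (beta * Num.sqrt s) *: (∇f (x k) - ∇f (x k.-1))
          - (beta * Num.sqrt s / k%:R) *: ∇f (x k.-1)
    /\ x k.+1 = y k - s *: ∇f (y k).

(** [tau], [vseq] and [energy] are meaningful for [k >= 1] only. *)
Definition tau (k : nat) : R := (k%:R - 1) / (alpha - 1).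

Definition vseq (x : H^nat) (xstar : H) (k : nat) : H :=
  x k.-1 - xstar
  + tau k *: (x k - x k.-1 + (beta * Num.sqrt s) *: ∇f (x k.-1)).

Definition energy (x : H^nat) (xstar : H) (k : nat) : R :=
  tau k ^+ 2 * (f (x k) - minval f)
  + 1 / (2 * s) * `|vseq x xstar k| ^+ 2.

End igahd.

(** [min_upto u k] is the minimum of [u 1, ..., u k] when [k >= 1]. *)
Definition min_upto (R : realType) (u : R^nat) (k : nat) : R :=
  \big[Order.min/u 1%N]_(1 <= i < k.+1) u i.

(* Main.v *)
Require Import Defs.
From HB Require Import structures.
From mathcomp Require Import all_boot all_order all_algebra.
From mathcomp Require Import all_classical all_reals all_analysis.
From mathcomp Require Import ring lra.

Set Implicit Arguments.
Unset Strict Implicit.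
Unset Printing Implicit Defensive.

Import Order.TTheory GRing.Theory Num.Theory.
Import numFieldNormedType.Exports.

Local Open Scope classical_set_scope.
Local Open Scope ring_scope.

(** Write [t := tau k.+1], [b := beta * Num.sqrt s], [g] and [h] for the
    gradients at [x k] and [y k].  The coefficients of the algorithm are chosen
    so that [vseq] telescopes: its increment is just [- (s * t) *: h]
    ([vseq_step]), and [vseq k] is an explicit combination of [y k - xstar],
    [y k - x k] and [g] ([vseq_extrapolated]).  Expanding the square, the energy
    increment contains [- t * dot h (y k - xstar)],
    [- t * (t - 1) * dot h (y k - x k)] and [- b * t ^+ 2 * dot h g].  The first
    two are absorbed by the interpolation inequality for convex functions with
    Lipschitz gradient ([cocoercive_le]), used from [xstar] and from [x k] to
    [y k]; the descent inequality pays for the step from [y k] to [x k.+1].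

    What is left is [- t ^+ 2 / (2 * L)] times the quadratic form
      [(1 + s * L * (1 - s * L)) * `|h| ^+ 2 + `|g| ^+ 2
       - 2 * (1 - b * L) * dot h g]
    plus a remainder of order [t] only ([energy_step]).  The form is positive
    definite exactly when [(1 - b * L) ^+ 2 < 1 + s * L * (1 - s * L)], which is
    what the hypothesis on [beta] says ([quadratic_form_coercive]).  So for
    large [k] the quadratic decrease wins over the remainder
    ([coercive_absorption]), and the energy drops by at least a constant times
    [k ^+ 2 * (`|h| ^+ 2 + `|g| ^+ 2)] ([energy_decrease]).

    Everything else follows from this one inequality: the energy is eventually
    nonincreasing, hence bounded, and it dominates [tau k ^+ 2] times the
    optimality gap; the drops are summable since the energy is nonnegative
    ([lyapunov_summable]); and summability of [k ^+ 2 * w k] forces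
    [k ^+ 2 * w k] to vanish in the limit ([weighted_cvg0]) and the running
    minimum of [w] to be at most a multiple of [k ^- 3], because
    [\sum_(i <= k) i ^+ 2] grows like [k ^+ 3] ([min_upto_bigO]). *)

(** * Inner product *)

Section inner_product.
Context (R : realType) (H : completeNormedModType R) (dot : {dot H for idfun}).
Implicit Types u v w : H.

Lemma dotC u v : dot u v = dot v u.
Proof. by have := @hermitian_subproof _ _ _ _ dot u v; rewrite /= expr0 mul1r. Qed.

Lemma dotDl u v w : dot (u + v) w = dot u w + dot v w.
Proof. exact: linearDl. Qed.

Lemma dotNl u w : dot (- u) w = - dot u w.
Proof. exact: linearNl. Qed.

Lemma dotZl (a : R) u w : dot (a *: u) w = a * dot u w.
Proof. exact: linearZl_LR. Qed.

Lemma dotDr u v w : dot w (u + v) = dot w u + dot w v.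
Proof. exact: linearDr. Qed.

Lemma dotNr u w : dot w (- u) = - dot w u.
Proof. by rewrite dotC dotNl dotC. Qed.

Lemma dotZr (a : R) u w : dot w (a *: u) = a * dot w u.
Proof. by rewrite dotC dotZl dotC. Qed.

Definition dotE := (dotDl, dotNl, dotZl, dotDr, dotNr, dotZr).

Hypothesis hdot : induces_norm dot.

Lemma dot_inj u v : (forall w, dot u w = dot v w) -> u = v.
Proof.
move=> uv; apply/eqP; rewrite -subr_eq0 -normr_eq0 -sqrf_eq0 hdot.
by rewrite dotDl dotNl uv subrr.
Qed.

(** Vector identities become identities between scalars, within reach of
    [ring] and [field], once tested against an arbitrary linear form. *)
Lemma eq_linear_forms (u v : H) :
  (forall phi : H -> R, {morph phi : a b / a + b} -> {morph phi : a / - a} ->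
    (forall c, {morph phi : a / c *: a >-> c * a}) -> phi u = phi v) ->
  u = v.
Proof.
move=> uv; apply: dot_inj => w; apply: (uv (fun a => dot a w)).
- by move=> a b; exact: dotDl.
- by move=> a; exact: dotNl.
- by move=> c a; exact: dotZl.
Qed.

Lemma dot_ge0 u : 0 <= dot u u.
Proof. by rewrite -hdot sqr_ge0. Qed.

(** Expand [0 <= `|u - p *: v| ^+ 2]. *)
Lemma young (p : R) u v : 0 < p ->
  2 * dot u v <= p^-1 * `|u| ^+ 2 + p * `|v| ^+ 2.
Proof.
move=> p0; have p1 : p * p^-1 = 1 by rewrite mulfV ?gt_eqF.
have ip : 0 < p^-1 by rewrite invr_gt0.
have := dot_ge0 (u - p *: v); rewrite !dotE (dotC v u) !hdot => h.
have := mulr_ge0 (ltW ip) h.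
set q := p^-1 in p1 ip *.
have -> : q * (dot u u + - (p * dot u v) + - (p * (dot u v + - (p * dot v v))))
  = q * dot u u - 2 * (p * q) * dot u v + (p * q) * (p * dot v v) by ring.
by rewrite p1; lra.
Qed.

End inner_product.

(** * Convex functions with Lipschitz gradient *)

(** A one-sided, integral-free form of integrating [dphi] over the unit
    interval: the mean value theorem for [phi] minus the primitive
    [p * t + M / 2 * t ^+ 2] of the bound. *)
Lemma MVT_linear_bound (R : realType) (phi dphi : R -> R) (p M : R) :
  (forall t : R, is_derive t 1 phi (dphi t)) ->
  (forall t, 0 < t -> t < 1 -> dphi t <= p + M * t) ->
  phi 1 - phi 0 <= p + M / 2.
Proof.
move=> dphiE dphi_le.
pose psi (t : R) : R := phi t - (p * t + M / 2 * t ^+ 2).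
have dpsi (t : R) : is_derive t 1 psi (dphi t - (p + M * t)).
  have := dphiE t => ?.
  by apply: is_derive_eq; rewrite /GRing.scale/=; field.
have cpsi : continuous psi.
  by move=> t; apply/differentiable_continuous/derivable1_diffP; have [] := dpsi t.
have [c c01] := MVT ltr01 (fun t _ => dpsi t) (continuous_subspaceT cpsi).
rewrite subr0 mulr1 /psi => E.
have := dphi_le c; rewrite (itvP c01) => /(_ erefl); rewrite (itvP c01) => /(_ erefl).
by move: E; rewrite !(expr0n, expr1n) /=; lra.
Qed.

Section smooth_convex.
Context (R : realType) (H : completeNormedModType R) (dot : {dot H for idfun}).
Hypothesis hdot : induces_norm dot.
Context (f : H -> R^o).
Hypothesis fdiff : forall x : H, differentiable f x.
Local Notation "'∇f'" := (grad dot f).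

(** Directional difference quotients of [f] along [d] are literally those of
    the restriction of [f] to the line. *)
Lemma is_derive_line (x d : H) (t : R) :
  is_derive t 1 (fun r : R => f (x + r *: d) : R) (dot (∇f (x + t *: d)) d).
Proof.
have E : (fun h : R => h^-1 *: ((f (x + (h *: (1 : R^o) + t) *: d) : R^o)
                                - f (x + t *: d)))
       = (fun h : R => h^-1 *: (f (h *: d + (x + t *: d)) - f (x + t *: d))).
  apply/funext => h; congr (_ *: (f _ - _)).
  by rewrite [h *: 1]mulr1 scalerDl addrCA.
split.
  by rewrite /derivable /= E; exact: diff_derivable.
by rewrite /derive /= E -[LHS]/('D_d f _) deriveE// (gradP hdot).
Qed.

Context (L : R) (L0 : 0 < L) (flip : L.-lipschitz (∇f)).

Lemma lip_grad u v : `|∇f u - ∇f v| <= L * `|u - v|.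
Proof. exact: (@flip (u, v)). Qed.

(** The descent inequality and its lower counterpart: the mean value bound
    applied to [f] and to [- f] on the segment from [x] to [x + d]. *)
Lemma taylor_grad (x d : H) :
  `|f (x + d) - f x - dot (∇f x) d| <= L / 2 * `|d| ^+ 2.
Proof.
(* Young's inequality with weight [L * t] replaces Cauchy-Schwarz. *)
have dot_le (p q : H) (t : R) : 0 < t -> `|p - q| <= L * (t * `|d|) ->
    dot p d <= dot q d + L * `|d| ^+ 2 * t.
  move=> t0 ple; have Lt0 : 0 < L * t by rewrite mulr_gt0.
  have := young hdot (p - q) d Lt0; rewrite dotDl dotNl.
  have : (L * t)^-1 * `|p - q| ^+ 2 <= L * t * `|d| ^+ 2.
    rewrite ler_pdivrMl//; apply: (@le_trans _ _ ((L * (t * `|d|)) ^+ 2)).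
      by rewrite ler_pXn2r// nnegrE// ?mulr_ge0 ?(ltW L0) ?(ltW t0).
    by rewrite le_eqVlt; apply/orP; left; apply/eqP; ring.
  by lra.
have lip t : 0 < t -> `|∇f (x + t *: d) - ∇f x| <= L * (t * `|d|).
  move=> t0; apply: le_trans (lip_grad _ _) _.
  by rewrite addrC addKr normrZ gtr0_norm.
rewrite ler_norml; apply/andP; split.
  have := @MVT_linear_bound _ (fun t => - (f (x + t *: d) : R))
    (fun t => - dot (∇f (x + t *: d)) d) (- dot (∇f x) d) (L * `|d| ^+ 2).
  rewrite scale1r scale0r addr0 => h; suff: - (f (x + d) : R) - - (f x : R) <=
    - dot (∇f x) d + L * `|d| ^+ 2 / 2 by lra.
  apply: h => t; first exact: (is_deriveN (is_derive_line x d t)).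
  move=> t0 _; rewrite lerNl opprD opprK lerBlDr; apply: dot_le => //.
  by rewrite distrC lip.
have := @MVT_linear_bound _ (fun t => (f (x + t *: d) : R))
    (fun t => dot (∇f (x + t *: d)) d) (dot (∇f x) d) (L * `|d| ^+ 2).
rewrite scale1r scale0r addr0 => h; suff: (f (x + d) : R) - (f x : R) <=
    dot (∇f x) d + L * `|d| ^+ 2 / 2 by lra.
apply: h => t; first exact: (is_derive_line x d t).
by move=> t0 _; apply: dot_le => //; rewrite lip.
Qed.

Hypothesis fconvex : convex_function setT f.

(** Compare the chord bound from convexity with the quadratic lower bound of
    [taylor_grad] at [x + t *: d], divide by [t] and let [t] tend to [0]; the
    quadratic error [A * t] vanishes. *)
Lemma convex_grad_le (x d : H) : f x + dot (∇f x) d <= f (x + d).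
Proof.
set A := L / 2 * `|d| ^+ 2.
have A0 : 0 <= A by rewrite mulr_ge0 ?divr_ge0 ?sqr_ge0 ?ltW.
have key t : 0 < t -> t <= 1 -> f x + dot (∇f x) d <= f (x + d) + A * t.
  move=> t0 t1.
  have h1 : f (x + t *: d) <= t * f (x + d) + (1 - t) * f x.
    have -> : x + t *: d = t *: (x + d) + (1 - t) *: x.
      by rewrite scalerDr scalerBl scale1r [RHS]addrC addrA subrK.
    exact: (@fconvex (Itv01 (ltW t0) t1) (x + d) x (in_setT _) (in_setT _)).
  have := taylor_grad x (t *: d); rewrite normrZ gtr0_norm// exprMn dotZr.
  rewrite ler_norml => /andP[h2 _].
  rewrite -(ler_pM2l t0); by move: h1 h2; rewrite /A; nra.
have [A1|] := ltP 0 A; last by have := key 1 ltr01 (lexx 1); lra.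
apply/ler_addgt0Pr => e e0.
have q0 : 0 < Num.min 1 (e / A) by rewrite lt_min ltr01 divr_gt0.
apply: le_trans (key _ q0 _) _; first by rewrite ge_min lexx.
by rewrite lerD2l mulrC -ler_pdivlMr// ge_min lexx orbT.
Qed.

(** The intermediate point is [x - L^-1 *: (grad x - grad y)]: it lies above the
    tangent plane of [f] at [y] by convexity, and the descent inequality from
    [x] bounds its value; this step length makes the gain largest. *)
Lemma cocoercive_le (x y : H) :
  f y <= f x + dot (∇f y) (y - x) - (2 * L)^-1 * `|∇f y - ∇f x| ^+ 2.
Proof.
have := taylor_grad x (- (L^-1 *: (∇f x - ∇f y))).
have := convex_grad_le y (x - L^-1 *: (∇f x - ∇f y) - y).
rewrite [y + _]addrC subrK ler_norml => h1 /andP[_].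
move: (∇f x) (∇f y) h1 => p q; rewrite (distrC q p).
set w := p - q => h1.
rewrite normrN normrZ gtr0_norm ?invr_gt0// exprMn => h2.
have LK : L * L^-1 = 1 by rewrite mulfV ?gt_eqF.
have ww : `|w| ^+ 2 = dot p w - dot q w by rewrite hdot {1}/w dotDl dotNl.
move: h1 h2; rewrite !dotE invfM ww.
move: LK; move: (L^-1) => l LK h1 h2.
have E : L / 2 * (l ^+ 2 * (dot p w - dot q w)) =
  L * l * (l / 2 * (dot p w - dot q w)) by ring.
by move: h2; rewrite E LK /w !dotE; lra.
Qed.

End smooth_convex.

(** * Algebra of one step *)

Section identities.
Context (R : realType) (H : completeNormedModType R) (dot : {dot H for idfun}).
Hypothesis hdot : induces_norm dot.

(** With [m = alpha - 1] and [n = k] this rewrites [vseq] at [k] through the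
    extrapolated point: [n / m * (1 - (m + 1) / n)] is [(n - 1) / m - 1], and the
    correction [b / n] turns [n / m] in front of [g'] into [(n - 1) / m]. *)
Lemma extrapolation_identity (m n b : R) (X X' Y z g g' : H) :
  m != 0 -> n != 0 ->
  Y = X + (1 - (m + 1) / n) *: (X - X') - b *: (g - g') - (b / n) *: g' ->
  X' - z + ((n - 1) / m) *: (X - X' + b *: g')
  = Y - z + (n / m - 1) *: (Y - X) + (b * (n / m)) *: g.
Proof.
move=> m0 n0 ->; apply: (eq_linear_forms hdot) => phi phiD phiN phiZ.
by rewrite !(phiD, phiN, phiZ); field; rewrite m0 n0.
Qed.

Lemma step_identity (t s b : R) (X Y z g h : H) :
  X - z + t *: (Y - s *: h - X + b *: g)
  = Y - z + (t - 1) *: (Y - X) + (b * t) *: g - (s * t) *: h.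
Proof.
apply: (eq_linear_forms hdot) => phi phiD phiN phiZ.
by rewrite !(phiD, phiN, phiZ); ring.
Qed.

(** The scalar core of the energy estimate, with [t = tau k.+1] and
    [t' = tau k].  Once [`|V - (s * t) *: h| ^+ 2] is expanded it is [2 * L] times
    the sum of the descent inequality with weight [t ^+ 2], the two interpolation
    inequalities with weights [t ^+ 2 - t] and [t], and [fz <= fx] with weight
    [t' ^+ 2 - (t ^+ 2 - t)]. *)
Lemma energy_increment_bound (t t' b s L : R) (X Y z g h V : H)
    (fx' fx fy fz : R) :
  V = Y - z + (t - 1) *: (Y - X) + (b * t) *: g ->
  0 < L -> 0 < s -> 1 <= t -> t ^+ 2 - t <= t' ^+ 2 -> fz <= fx ->
  fx' <= fy - s * `|h| ^+ 2 + L / 2 * (s ^+ 2 * `|h| ^+ 2) ->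
  fy <= fx + dot h (Y - X) - (2 * L)^-1 * `|h - g| ^+ 2 ->
  fy <= fz + dot h (Y - z) - (2 * L)^-1 * `|h| ^+ 2 ->
  2 * L * (t ^+ 2 * (fx' - fz) + 1 / (2 * s) * `|V - (s * t) *: h| ^+ 2
           - (t' ^+ 2 * (fx - fz) + 1 / (2 * s) * `|V| ^+ 2))
  <= - t ^+ 2 * ((1 + s * L * (1 - s * L)) * `|h| ^+ 2 + `|g| ^+ 2
                 - 2 * (1 - b * L) * dot h g)
     + t * (`|h - g| ^+ 2 - `|h| ^+ 2).
Proof.
move=> VE0 L0 s0 t1 tt' fzx descent fyx fyz.
have VE W : `|W - (s * t) *: h| ^+ 2 =
    `|W| ^+ 2 - 2 * s * t * dot h W + s ^+ 2 * t ^+ 2 * `|h| ^+ 2.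
  by rewrite !hdot !dotE (dotC dot W h); ring.
have hV : dot h V = dot h (Y - z) + (t - 1) * dot h (Y - X) + b * t * dot h g.
  by rewrite VE0 !(dotDr, dotZr).
have hg : `|h - g| ^+ 2 = `|h| ^+ 2 + `|g| ^+ 2 - 2 * dot h g.
  by rewrite !hdot !dotE (dotC dot g h); ring.
rewrite VE hV; rewrite hg in fyx *; clear VE hV hg.
move: (`|h| ^+ 2) (`|g| ^+ 2) (dot h g) (dot h (Y - X)) (dot h (Y - z)) (`|V| ^+ 2)
  descent fyx fyz.
move=> A B C P Q W.
have -> : 1 / (2 * s) * (W - 2 * s * t * (Q + (t - 1) * P + b * t * C)
    + s ^+ 2 * t ^+ 2 * A) =
  1 / (2 * s) * W - t * (Q + (t - 1) * P + b * t * C) + s / 2 * t ^+ 2 * A.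
  by field; rewrite gt_eqF.
move=> descent fyx fyz.
have t0 : 0 <= t by rewrite (le_trans ler01).
have tt : 0 <= t ^+ 2 - t by rewrite expr2 -{3}[t]mulr1 -mulrBr mulr_ge0// subr_ge0.
have i1 := ler_wpM2l (sqr_ge0 t) descent.
have i2 := ler_wpM2l tt fyx.
have i3 := ler_wpM2l t0 fyz.
have i4 : 0 <= (t' ^+ 2 - (t ^+ 2 - t)) * (fx - fz).
  by rewrite mulr_ge0// subr_ge0.
have L2 : 0 < 2 * L by rewrite mulr_gt0.
rewrite -(ler_pM2l (_ : 0 < (2 * L)^-1)) ?invr_gt0// mulKf ?gt_eqF//.
have LE : (2 * L)^-1 * (1 + s * L * (1 - s * L)) = (2 * L)^-1 + s / 2 * (1 - s * L).
  by field; rewrite gt_eqF.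
have LC : (2 * L)^-1 * (2 * (1 - b * L)) = 2 * (2 * L)^-1 - b.
  by field; rewrite gt_eqF.
have -> : (2 * L)^-1 *
    (- t ^+ 2 * ((1 + s * L * (1 - s * L)) * A + B - 2 * (1 - b * L) * C)
     + t * (A + B - 2 * C - A)) =
  - t ^+ 2 * ((2 * L)^-1 * (1 + s * L * (1 - s * L)) * A + (2 * L)^-1 * B
              - (2 * L)^-1 * (2 * (1 - b * L)) * C)
  + t * ((2 * L)^-1 * (B - 2 * C)) by ring.
rewrite LE LC.
move: i1 i2 i3 i4; move: ((2 * L)^-1) => l i1 i2 i3 i4.
by lra.
Qed.

(** Completing the square with [(1 - c) *: v - r *: u] reduces coercivity with
    constant [c] to [r ^+ 2 <= (P - c) * (1 - c)]. *)
Lemma quadratic_form_coercive (P r : R) : r ^+ 2 < P ->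
  exists2 c, 0 < c < 1 & forall u v : H,
    c * (`|u| ^+ 2 + `|v| ^+ 2) <=
    P * `|u| ^+ 2 + `|v| ^+ 2 - 2 * r * dot u v.
Proof.
move=> rP; have r0 := sqr_ge0 r; have P1 : 0 < P + 1 by lra.
(* With this [c], [(P - c) * (1 - c) - r ^+ 2] is exactly [c ^+ 2]. *)
pose c := (P - r ^+ 2) / (P + 1).
have cE : c * (P + 1) = P - r ^+ 2 by rewrite divfK ?gt_eqF.
have c0 : 0 < c by rewrite divr_gt0// subr_gt0.
have c1 : c < 1 by rewrite ltr_pdivrMr// mul1r; lra.
exists c; first by rewrite c0.
move=> u v; clearbody c.
have := dot_ge0 hdot ((1 - c) *: v - r *: u).
rewrite !dotE (dotC dot v u) !hdot => sq.
have uge0 := dot_ge0 hdot u.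
have disc : 0 <= ((P - c) * (1 - c) - r ^+ 2) * dot u u.
  rewrite mulr_ge0//; have -> : (P - c) * (1 - c) - r ^+ 2 = c ^+ 2.
    have -> : r ^+ 2 = P - c * (P + 1) by rewrite cE; ring.
    by ring.
  exact: sqr_ge0.
rewrite -subr_ge0 -(@pmulr_rge0 _ (1 - c)) ?subr_gt0//.
move: sq disc; move: (dot u u) (dot v v) (dot u v) => A B C; lra.
Qed.

(** With [S := `|h| ^+ 2 + `|g| ^+ 2], the remainder is at most [2 * t * S], and
    [4 <= t * c] makes half of the coercive term, [c / 2 * t ^+ 2 * S], large
    enough to absorb it. *)
Lemma coercive_absorption (P r c t L E E' : R) (h g : H) :
  0 < L -> 0 <= t -> 4 <= t * c ->
  c * (`|h| ^+ 2 + `|g| ^+ 2) <=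
    P * `|h| ^+ 2 + `|g| ^+ 2 - 2 * r * dot h g ->
  2 * L * (E' - E) <=
    - t ^+ 2 * (P * `|h| ^+ 2 + `|g| ^+ 2 - 2 * r * dot h g)
    + t * (`|h - g| ^+ 2 - `|h| ^+ 2) ->
  E' + c / (4 * L) * t ^+ 2 * (`|h| ^+ 2 + `|g| ^+ 2) <= E.
Proof.
move=> L0 t0 tc co st.
have yg := young hdot h (- g) ltr01.
have hg : `|h - g| ^+ 2 = `|h| ^+ 2 + `|g| ^+ 2 - 2 * dot h g.
  by rewrite !hdot !dotE (dotC dot g h); ring.
rewrite hg in st; rewrite dotNr normrN invr1 !mul1r in yg.
have A0 := sqr_ge0 `|h|; have B0 := sqr_ge0 `|g|.
move: (`|h| ^+ 2) (`|g| ^+ 2) (dot h g) A0 B0 co yg st {hg} => A B C A0 B0 co yg st.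
rewrite -lerBrDl -(ler_pM2l (_ : 0 < 2 * L)) ?mulr_gt0//.
have -> : 2 * L * (c / (4 * L) * t ^+ 2 * (A + B)) = c / 2 * t ^+ 2 * (A + B).
  by field; rewrite gt_eqF.
have h1 := ler_wpM2l (sqr_ge0 t) co.
have h2 := ler_wpM2l t0 yg.
have h3 : 0 <= (t * c - 4) * (t * (A + B)).
  by rewrite mulr_ge0 ?subr_ge0 ?mulr_ge0 ?addr_ge0.
have h4 : 0 <= t * A by rewrite mulr_ge0.
by lra.
Qed.

End identities.

(** * Energy decrease *)

Section energy.
Context (R : realType) (H : completeNormedModType R) (dot : {dot H for idfun}).
Hypothesis hdot : induces_norm dot.
Context (f : H -> R^o).
Hypothesis fdiff : forall x : H, differentiable f x.
Hypothesis fconvex : convex_function setT f.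
Local Notation "'∇f'" := (grad dot f).
Context (L : R) (L0 : 0 < L) (flip : L.-lipschitz (∇f)).

Lemma minvalE z : argmin f z -> minval f = f z.
Proof.
move=> fz; apply/eqP; rewrite eq_le; apply/andP; split.
  by apply: ge_inf; [exists (f z) => _ [w _ <-]; exact: fz|exists z].
by apply: lb_le_inf; [exists (f z), z|move=> _ [w _ <-]; exact: fz].
Qed.

(** A gradient step of length [L^-1] from a minimizer decreases [f] by at least
    [`|grad| ^+ 2 / (2 * L)]. *)
Lemma grad_argmin z : argmin f z -> ∇f z = 0.
Proof.
move=> fz; have := taylor_grad hdot fdiff L0 flip z (- (L^-1 *: ∇f z)).
have := fz (z - L^-1 *: ∇f z).
move: (f (z - _)) (f z) => a b ab; move: (∇f z) => g.
rewrite ler_norml => /andP[_].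
rewrite normrN normrZ gtr0_norm ?invr_gt0// exprMn !dotE -hdot => h.
have LK : L * L^-1 = 1 by rewrite mulfV ?gt_eqF.
have l0 : 0 < L^-1 by rewrite invr_gt0.
have E : L / 2 * (L^-1 ^+ 2 * `|g| ^+ 2) = L * L^-1 * (L^-1 / 2 * `|g| ^+ 2).
  by ring.
apply/eqP; rewrite -normr_eq0 -sqrf_eq0 eq_le sqr_ge0 andbT.
by rewrite -(pmulr_rle0 _ l0); move: h; rewrite E LK; lra.
Qed.

Context (alpha beta s : R) (halpha : 3 <= alpha) (s0 : 0 < s).
Context (x y : H^nat) (hxy : igahd dot f alpha beta s x y).
Local Notation b := (beta * Num.sqrt s).
Local Notation v := (vseq dot f alpha beta s x).
Local Notation E := (energy dot f alpha beta s x).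
Local Notation tau := (tau alpha).

Let alpha1 : 0 < alpha - 1.
Proof. by have := halpha; lra. Qed.

Lemma tauS k : tau k.+1 = k%:R / (alpha - 1).
Proof. by rewrite /Defs.tau -natr1 addrK. Qed.

Lemma vseq_extrapolated z k : (1 <= k)%N ->
  v z k = (y k - z) + (tau k.+1 - 1) *: (y k - x k) + (b * tau k.+1) *: ∇f (x k).
Proof.
move=> k1; have [yE _] := hxy k1; rewrite tauS.
apply: (extrapolation_identity hdot).
- by rewrite gt_eqF.
- by rewrite pnatr_eq0 -lt0n.
- by rewrite subrK.
Qed.

Lemma vseq_step z k : (1 <= k)%N ->
  v z k.+1 = v z k - (s * tau k.+1) *: ∇f (y k).
Proof.
move=> k1; rewrite (vseq_extrapolated z k1); have [_ xE] := hxy k1.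
by rewrite /vseq /= xE; exact: (step_identity hdot).
Qed.

(** This is where [3 <= alpha] enters: [tau] advances by [(alpha - 1)^-1], and
    [2 * (alpha - 1)^-1 <= 1]. *)
Lemma tau_sqr_le k : tau k.+1 ^+ 2 - tau k.+1 <= tau k ^+ 2.
Proof.
have -> : tau k = tau k.+1 - (alpha - 1)^-1.
  by rewrite tauS /Defs.tau mulrBl mul1r.
have i0 : 0 < (alpha - 1)^-1 by rewrite invr_gt0.
have i1 : (alpha - 1)^-1 <= 2^-1 by rewrite lef_pV2 ?posrE//; have := halpha; lra.
have t0 : 0 <= tau k.+1 by rewrite tauS mulr_ge0 // ltW.
by move: i0 i1 t0; move: (_^-1) (tau _) => i t; nra.
Qed.

Lemma energy_step z k : argmin f z -> (1 <= k)%N -> 1 <= tau k.+1 ->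
  2 * L * (E z k.+1 - E z k) <=
  - tau k.+1 ^+ 2 *
     ((1 + s * L * (1 - s * L)) * `|∇f (y k)| ^+ 2 + `|∇f (x k)| ^+ 2
      - 2 * (1 - b * L) * dot (∇f (y k)) (∇f (x k)))
  + tau k.+1 * (`|∇f (y k) - ∇f (x k)| ^+ 2 - `|∇f (y k)| ^+ 2).
Proof.
move=> fz k1 t1.
have i1 := taylor_grad hdot fdiff L0 flip (y k) (- (s *: ∇f (y k))).
have i2 := cocoercive_le hdot fdiff L0 flip fconvex (x k) (y k).
have i3 := cocoercive_le hdot fdiff L0 flip fconvex z (y k).
have i4 := fz (x k).
have i5 := tau_sqr_le k.
rewrite (grad_argmin fz) subr0 in i3.
have [_ xE] := hxy k1.
rewrite /energy (vseq_step _ k1) (vseq_extrapolated _ k1) (minvalE fz) xE.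
apply: (energy_increment_bound hdot erefl L0 s0 t1 i5 i4 _ i2 i3).
move: i1; rewrite ler_norml => /andP[_].
by rewrite normrN normrZ (gtr0_norm s0) exprMn dotNr dotZr -hdot; lra.
Qed.

Hypothesis sL : s <= 1 / L.
Hypothesis hbeta : 0 < beta * L * Num.sqrt s
               < 1 + Num.sqrt (1 + s * L * (1 - s * L)).

(** The coercive part of [energy_step] is of order [tau k.+1 ^+ 2], its remainder
    of order [tau k.+1]; [coercive_absorption] applies as soon as
    [4 <= tau k.+1 * c], where [c] is the coercivity constant. *)
Lemma energy_decrease : exists2 N, (1 <= N)%N & exists2 c, 0 < c &
  forall z k, argmin f z -> (N <= k)%N ->
    E z k.+1 + c * (k%:R ^+ 2 * (`|∇f (y k)| ^+ 2 + `|∇f (x k)| ^+ 2)) <= E z k.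
Proof.
pose P := 1 + s * L * (1 - s * L).
have P1 : 1 <= P.
  have sL1 : s * L <= 1 by rewrite -ler_pdivlMr.
  by rewrite /P lerDl mulr_ge0 ?subr_ge0// mulr_ge0// ltW.
pose r := 1 - b * L.
(* [- Num.sqrt P < r] is the assumption on [beta]; [r < 1 <= Num.sqrt P]. *)
have rP : r ^+ 2 < P.
  have P0 : 0 <= P by rewrite (le_trans ler01).
  have q1 : 1 <= Num.sqrt P by rewrite -sqrtr1 ler_wsqrtr.
  have := hbeta; rewrite -/P -[in X in _ -> is_true (_ < X)](sqr_sqrtr P0).
  rewrite /r => /andP[].
  move: (Num.sqrt P) q1 => q q1 h1 h2.
  rewrite -subr_gt0 subr_sqr mulr_gt0//; lra.
have [c /andP[c0 c1] coercive] := quadratic_form_coercive hdot rP.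
pose N := (Num.bound (4 / c * (alpha - 1))).+1.
exists N => //; exists (c / (4 * L * (alpha - 1) ^+ 2)).
  by rewrite divr_gt0// !mulr_gt0// exprn_gt0.
move=> z k fz Nk; have k1 : (1 <= k)%N by exact: leq_trans Nk.
have tc : 4 <= tau k.+1 * c.
  rewrite tauS -ler_pdivrMr// ler_pdivlMr//.
  apply: le_trans (_ : N%:R <= _); last by rewrite ler_nat.
  apply: ltW; apply: lt_le_trans (archi_boundP _) _.
    by rewrite mulr_ge0 ?divr_ge0 ?ltW.
  by rewrite ler_nat leqnSn.
have t1 : 1 <= tau k.+1.
  have tge0 : 0 <= tau k.+1 by rewrite tauS divr_ge0 ?ler0n ?(ltW alpha1).
  by have := ler_piMr tge0 (ltW c1); lra.
have -> S : c / (4 * L * (alpha - 1) ^+ 2) * (k%:R ^+ 2 * S) =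
    c / (4 * L) * tau k.+1 ^+ 2 * S.
  rewrite tauS; move: alpha1; move: (alpha - 1) k%:R => m n m0.
  by field; rewrite !gt_eqF.
apply: (coercive_absorption hdot L0 _ tc (coercive _ _) (energy_step fz k1 t1)).
exact: le_trans ler01 t1.
Qed.

Lemma energy_ge0 z k : argmin f z -> 0 <= E z k.
Proof.
move=> fz; rewrite /energy (minvalE fz) addr_ge0// mulr_ge0 ?sqr_ge0//.
  by rewrite subr_ge0; exact: fz.
by rewrite divr_ge0// mulr_ge0// ltW.
Qed.

Lemma energy_ge_value z k : tau k ^+ 2 * (f (x k) - minval f) <= E z k.
Proof.
by rewrite /energy lerDl mulr_ge0 ?sqr_ge0// divr_ge0// mulr_ge0// ltW.
Qed.

Lemma value_bigO z (C : R) N : argmin f z ->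
  (forall k, (N <= k)%N -> E z k <= C) ->
  (fun k => f (x k) - minval f) =O_\oo (fun k => k%:R ^- 2 : R^o).
Proof.
move=> fz EC; have C0 : 0 <= C := le_trans (energy_ge0 N fz) (EC N (leqnn N)).
have D0 : 0 <= 4 * (alpha - 1) ^+ 2 * C.
  by rewrite mulr_ge0// mulr_ge0// sqr_ge0.
apply/eqO_exP; exists (4 * (alpha - 1) ^+ 2 * C + 1).
  by rewrite ltr_wpDl.
exists (N + 2)%N => // k /= Nk.
have k2 : (2 <= k)%N by rewrite (leq_trans _ Nk)// leq_addl.
have gap0 : 0 <= f (x k) - minval f by rewrite (minvalE fz) subr_ge0; exact: fz.
have k0 : 0 < k%:R ^+ 2 :> R by rewrite exprn_gt0// ltr0n (leq_trans _ k2).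
rewrite ger0_norm// gtr0_norm ?invr_gt0// ler_pdivlMr//.
have EkC := le_trans (energy_ge_value z k) (EC k (leq_trans (leq_addr _ _) Nk)).
(* [k <= 2 * (k - 1)] for [2 <= k]. *)
have ktau : k%:R ^+ 2 <= 4 * (alpha - 1) ^+ 2 * tau k ^+ 2.
  have -> : 4 * (alpha - 1) ^+ 2 * tau k ^+ 2 = (2 * (k%:R - 1)) ^+ 2.
    rewrite /Defs.tau; move: alpha1; move: (alpha - 1) => m m0.
    by field; rewrite gt_eqF.
  have k2R : (2 : R) <= k%:R by rewrite ler_nat.
  by rewrite ler_pXn2r// ?nnegrE; lra.
have := ler_wpM2l gap0 ktau.
have := ler_wpM2l (_ : 0 <= 4 * (alpha - 1) ^+ 2) EkC.
rewrite mulr_ge0 ?sqr_ge0// => /(_ isT).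
by move: (f (x k) - minval f) => G; lra.
Qed.

End energy.

(** * Weighted summability *)

Section weighted_sums.
Context (R : realType).
Implicit Types (u w r E : R^nat).

(** The decrease telescopes: the partial sums plus [c^-1 * E] do not grow past
    the index [N]. *)
Lemma lyapunov_summable E u (c : R) N : 0 < c ->
  (forall k, 0 <= E k) -> (forall k, 0 <= u k) ->
  (forall k, (N <= k)%N -> E k.+1 + c * u k <= E k) ->
  exists M, forall n, \sum_(1 <= k < n) u k <= M.
Proof.
move=> c0 E0 u0 Edec; exists (\sum_(1 <= k < N.+1) u k + c^-1 * E N.+1) => n.
apply: (@le_trans _ _ (\sum_(1 <= k < N.+1 + n) u k)).
  case: n => [|n]; first by rewrite big_geq// sumr_ge0.
  rewrite [leRHS](big_cat_nat _ (n := n.+1))//=; last by rewrite leq_addl.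
  by rewrite lerDl sumr_ge0.
suff : \sum_(1 <= k < N.+1 + n) u k + c^-1 * E (N.+1 + n)%N <=
    \sum_(1 <= k < N.+1) u k + c^-1 * E N.+1.
  by apply: le_trans; rewrite lerDl mulr_ge0// invr_ge0 ltW.
elim: n => [|n IH]; first by rewrite addn0.
apply: le_trans IH; rewrite addnS big_nat_recr//= -addrA lerD2l.
rewrite -(ler_pM2l c0) mulrDr !mulVKf ?gt_eqF// addrC.
by apply: Edec; rewrite addSn ltnW// ltnS leq_addr.
Qed.

Lemma sum_sqr_ge_cube k : k%:R ^+ 3 / 3 <= \sum_(1 <= i < k.+1) i%:R ^+ 2 :> R.
Proof.
elim: k => [|k IH]; first by rewrite big_geq// expr0n mul0r.
rewrite big_nat_recr//=; apply: le_trans (lerD IH (lexx _)).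
have := ler0n R k; rewrite -natr1; move: k%:R => n n0; nra.
Qed.

Context (w : R^nat) (M : R).
Hypothesis w0 : forall k, 0 <= w k.
Hypothesis wM : forall n, \sum_(1 <= k < n) k%:R ^+ 2 * w k <= M.

Let uge0 k : 0 <= k%:R ^+ 2 * w k.
Proof. by rewrite mulr_ge0// sqr_ge0. Qed.

Lemma weighted_nneseries_lty : (\sum_(1 <= k <oo) (k%:R ^+ 2 * w k)%:E < +oo)%E.
Proof.
apply: (@le_lt_trans _ _ M%:E); last exact: ltry.
apply: lime_le.
  by apply: is_cvg_nneseries => k _ _; rewrite lee_fin.
by apply: nearW => n; rewrite sumEFin lee_fin.
Qed.

Lemma weighted_cvg0 : (fun k => k%:R ^+ 2 * w k) @ \oo --> (0 : R).
Proof.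
apply: cvg_series_cvg_0; apply: nondecreasing_is_cvgn.
  apply/nondecreasing_seqP => n.
  by rewrite /series /= big_nat_recr//= lerDl.
exists M => _ [n _ <-]; rewrite /series /=.
case: n => [|n]; first by rewrite big_geq//; have := wM 0; rewrite big_geq.
by rewrite big_nat_recl//= expr0n mul0r add0r; have := wM n.+1; rewrite big_add1.
Qed.

(** Each of the first [k] terms of the sum is at least [i ^+ 2] times the running
    minimum, so [k ^+ 3 / 3] times the minimum is at most [M]. *)
Lemma min_upto_bigO : (min_upto w : nat -> R^o) =O_\oo (fun k => k%:R ^- 3 : R^o).
Proof.
have M0 : 0 <= M by have := wM 0; rewrite big_geq.
apply/eqO_exP; exists (3 * M + 1); first by rewrite ltr_wpDl// mulr_ge0.
exists 1%N => // k /= k1.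
have m0 : 0 <= min_upto w k by apply: le_bigmin.
have mle i : (1 <= i < k.+1)%N -> min_upto w k <= w i.
  by move=> ik; apply: (@bigmin_inf_seq _ _ _ _ _ i); rewrite ?mem_index_iota.
rewrite ger0_norm//.
have k0 : 0 < k%:R ^+ 3 :> R by rewrite exprn_gt0// ltr0n.
rewrite gtr0_norm ?invr_gt0// ler_pdivlMr//.
have : \sum_(1 <= i < k.+1) i%:R ^+ 2 * min_upto w k <= M.
  apply: le_trans (wM k.+1); apply: ler_sum_nat => i ik.
  by rewrite ler_wpM2l ?sqr_ge0// mle.
rewrite -mulr_suml => h.
have := ler_wpM2r m0 (sum_sqr_ge_cube k); lra.
Qed.

End weighted_sums.

Lemma norm_littleo (R : realType) (r : R^nat) (M : R) : (forall k, 0 <= r k) ->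
  (forall n, \sum_(1 <= k < n) k%:R ^+ 2 * r k ^+ 2 <= M) ->
  (r : nat -> R^o) =o_\oo (fun k => k%:R^-1 : R^o).
Proof.
move=> r0 rM; apply/eqoP => e e0.
have /cvgrPdist_lt /(_ (e ^+ 2)) := weighted_cvg0 (fun k => sqr_ge0 (r k)) rM.
rewrite exprn_gt0// => /(_ isT) [N _ hN].
exists N.+1 => // k /= Nk.
have := hN k (ltnW Nk); rewrite /= sub0r normrN => h.
have k0 : 0 < k%:R :> R by rewrite ltr0n (leq_trans _ Nk).
rewrite ger0_norm// gtr0_norm ?invr_gt0// ler_pdivlMr//.
rewrite -(@ler_pXn2r _ 2)// ?nnegrE ?mulr_ge0 ?(ltW e0) ?(ltW k0)//.
by rewrite exprMn mulrC (le_trans (ler_norm _))// ltW.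
Qed.

(** * Convergence rates *)

Theorem theorem2p1 (R : realType) (H : completeNormedModType R)
    (dot : {dot H for idfun}) (hdot : induces_norm dot)
    (f : H -> R^o)
    (fconvex : convex_function setT f)
    (fdiff : forall x : H, differentiable f x)
    (L : R) (L0 : 0 < L) (flip : L.-lipschitz (grad dot f))
    (X0 : argmin f !=set0)
    (alpha beta s : R) (halpha : 3 <= alpha) (s0 : 0 < s) (sL : s <= 1 / L)
    (beta0 : 0 < beta)
    (x y : H^nat) (hxy : igahd dot f alpha beta s x y)
    (hbeta : 0 < beta * L * Num.sqrt s
               < 1 + Num.sqrt (1 + s * L * (1 - s * L))) :
  [/\ (forall xstar : H, xstar \in argmin f ->
         exists2 N : nat, (1 <= N)%N &
           nonincreasing_seq
             (fun k => energy dot f alpha beta s x xstar (N + k)%N))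
      /\ (fun k => f (x k) - minval f) =O_\oo (fun k => k%:R ^- 2 : R^o),
      (\sum_(1 <= k <oo) (k%:R ^+ 2 * `|grad dot f (x k)| ^+ 2)%:E < +oo)%E
      /\ (\sum_(1 <= k <oo) (k%:R ^+ 2 * `|grad dot f (y k)| ^+ 2)%:E < +oo)%E,
      (fun k => `|grad dot f (x k)| : R^o) =o_\oo (fun k => k%:R^-1 : R^o)
      /\ (fun k => `|grad dot f (y k)| : R^o) =o_\oo (fun k => k%:R^-1 : R^o)
    & (min_upto (fun i => `|grad dot f (x i)| ^+ 2) : nat -> R^o)
        =O_\oo (fun k => k%:R ^- 3 : R^o)
      /\ (min_upto (fun i => `|grad dot f (y i)| ^+ 2) : nat -> R^o)
        =O_\oo (fun k => k%:R ^- 3 : R^o)].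
Proof.
have [N N1 [c c0 Edec]] :=
  energy_decrease hdot fdiff fconvex L0 flip halpha s0 hxy sL hbeta.
have Enonincr z k : argmin f z -> (N <= k)%N ->
    energy dot f alpha beta s x z k.+1 <= energy dot f alpha beta s x z k.
  move=> fz Nk; apply: le_trans (Edec z k fz Nk); rewrite lerDl.
  by rewrite mulr_ge0 ?(ltW c0)// mulr_ge0 ?sqr_ge0// addr_ge0 ?sqr_ge0.
have [z fz] := X0.
have [M hM] := lyapunov_summable c0
  (fun k => energy_ge0 dot alpha beta s0 x k fz)
  (fun k => mulr_ge0 (sqr_ge0 _) (addr_ge0 (sqr_ge0 _) (sqr_ge0 _)))
  (fun k Nk => Edec z k fz Nk).
have gx n : \sum_(1 <= k < n) k%:R ^+ 2 * `|grad dot f (x k)| ^+ 2 <= M.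
  apply: le_trans (hM n); apply: ler_sum => k _.
  by rewrite ler_wpM2l ?sqr_ge0// lerDr sqr_ge0.
have gy n : \sum_(1 <= k < n) k%:R ^+ 2 * `|grad dot f (y k)| ^+ 2 <= M.
  apply: le_trans (hM n); apply: ler_sum => k _.
  by rewrite ler_wpM2l ?sqr_ge0// lerDl sqr_ge0.
split.
- split=> [xstar|].
    move=> /set_mem fxs; exists N; first exact: N1.
    apply/nonincreasing_seqP => k; rewrite addnS.
    exact: Enonincr fxs (leq_addr _ _).
  apply: (value_bigO halpha s0 fz (beta := beta)
            (C := energy dot f alpha beta s x z N) (N := N)) => k.
  elim: k => [|k IH]; first by rewrite leqn0 => /eqP ->.
  rewrite leq_eqVlt => /orP[/eqP <- //|]; rewrite ltnS => Nk.
  exact: le_trans (Enonincr z k fz Nk) (IH Nk).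
- split; [exact: (weighted_nneseries_lty (fun k => sqr_ge0 _) gx)|].
  exact: (weighted_nneseries_lty (fun k => sqr_ge0 _) gy).
- by split; [exact: (norm_littleo (fun k => normr_ge0 _) gx)
            |exact: (norm_littleo (fun k => normr_ge0 _) gy)].
- split; [exact: (min_upto_bigO (fun k => sqr_ge0 _) gx)|].
  exact: (min_upto_bigO (fun k => sqr_ge0 _) gy).
Qed.
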